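(* The Levi-Civita connection $\nabla$ of the Bures-Wasserstein metric on $\mathrm{SPD}(n)$ is given, for all smooth vector fields $X,Y$ on $\mathrm{SPD}(n)$ and all $\Sigma\in\mathrm{SPD}(n)$, by $$(\nabla_XY)_{|\Sigma}=(\partial_XY)_{|\Sigma}-\big(X^0\Sigma Y^0+Y^0\Sigma X^0\big),$$ where $X^0,Y^0\in\mathrm{Sym}(n)$ are the unique symmetric matrices such that $X_\Sigma=\Sigma X^0+X^0\Sigma$ and $Y_\Sigma=\Sigma Y^0+Y^0\Sigma$.
   Context: $\mathrm{SPD}(n)$ is the manifold of real symmetric positive definite $n\times n$ matrices, an open subset of the space $\mathrm{Sym}(n)$ of symmetric matrices; tangent spaces are identified with $\mathrm{Sym}(n)$, so vector fields are maps $\mathrm{SPD}(n)\to\mathrm{Sym}(n)$. $\partial_XY$ is the derivation of coordinates in the global chart $\mathrm{SPD}(n)\hookrightarrow\mathrm{Sym}(n)$, i.e. $(\partial_XY)_{|\Sigma}=d_\Sigma Y(X_\Sigma)$. The Bures-Wasserstein metric is $g_\Sigma(X,X)=\frac12\sum_{i,j}\frac{1}{d_i+d_j}X_{ij}'^2$ where $\Sigma=PDP^\top$ with $P\in\mathrm{O}(n)$, $D=\mathrm{Diag}(d_1,\dots,d_n)$ and $X'=P^\top XP$. *)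

(* Defs.v *)
(* MathComp / MathComp-Analysis development, over an arbitrary realType. *)
From HB Require Import structures.
From mathcomp Require Import all_boot all_order all_algebra.
From mathcomp Require Import all_classical all_reals all_analysis.

Set Implicit Arguments.
Unset Strict Implicit.
Unset Printing Implicit Defensive.
Import Order.TTheory GRing.Theory Num.Theory.
Import numFieldNormedType.Exports.
Local Open Scope classical_set_scope.
Local Open Scope ring_scope.

(** Calculus on an open subset [U] of a finite-dimensional normed space [V].
    Maps on [U] are represented by total maps on [V]; since [U] is open, the
    notions below only depend on their restrictions to [U]. *)

(* In finite dimension, [f] is C^(k+1) on an open set iff it is differentiable
   there and every directional derivative [x |-> 'd f x v] is C^k. *)
Fixpoint Ck_on (R : realType) (V W : normedModType R) (U : set V) (k : nat)
    (f : V -> W) : Prop :=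
  match k with
  | 0 => forall x, U x -> {for x, continuous f}
  | j.+1 => (forall x, U x -> differentiable f x) /\
            (forall v : V, Ck_on U j (fun x => 'd f x v))
  end.

Definition smooth_on (R : realType) (V W : normedModType R) (U : set V)
    (f : V -> W) : Prop := forall k, Ck_on U k f.

Section LeviCivita.
Context {R : realType} {V : normedModType R}.
Implicit Types (U : set V) (X Y Z : V -> V) (f : V -> R).

(* In the global chart [U \subset V], tangent spaces are identified with [V]:
   [chart_deriv X Y] is the derivation \partial_X Y of coordinates. *)
Definition chart_deriv X Y : V -> V := fun x => 'd Y x (X x).

Definition lie_bracket X Y : V -> V :=
  fun x => chart_deriv X Y x - chart_deriv Y X x.

(* Additivity in the first argument together with [conn_scalel] is
   C^oo(U)-linearity; R-linearity in the second argument follows from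
   [conn_addr] and [conn_leibniz] applied to constant functions. *)
Record affine_connection U (nabla : (V -> V) -> (V -> V) -> (V -> V)) : Prop := {
  conn_smooth : forall X Y, smooth_on U X -> smooth_on U Y ->
    smooth_on U (nabla X Y);
  conn_addl : forall X X' Y, smooth_on U X -> smooth_on U X' ->
    smooth_on U Y -> forall x, U x ->
    nabla (fun y => X y + X' y) Y x = nabla X Y x + nabla X' Y x;
  conn_scalel : forall f X Y, smooth_on U f -> smooth_on U X ->
    smooth_on U Y -> forall x, U x ->
    nabla (fun y => f y *: X y) Y x = f x *: nabla X Y x;
  conn_addr : forall X Y Y', smooth_on U X -> smooth_on U Y ->
    smooth_on U Y' -> forall x, U x ->
    nabla X (fun y => Y y + Y' y) x = nabla X Y x + nabla X Y' x;
  conn_leibniz : forall f X Y, smooth_on U f -> smooth_on U X ->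
    smooth_on U Y -> forall x, U x ->
    nabla X (fun y => f y *: Y y) x
      = 'd f x (X x) *: Y x + f x *: nabla X Y x
}.

Definition torsion_free U (nabla : (V -> V) -> (V -> V) -> (V -> V)) : Prop :=
  forall X Y, smooth_on U X -> smooth_on U Y -> forall x, U x ->
    nabla X Y x - nabla Y X x = lie_bracket X Y x.

Definition metric_compatible U (g : V -> V -> V -> R)
    (nabla : (V -> V) -> (V -> V) -> (V -> V)) : Prop :=
  forall X Y Z, smooth_on U X -> smooth_on U Y -> smooth_on U Z ->
  forall x, U x ->
    'd (fun y => g y (Y y) (Z y)) x (X x)
      = g x (nabla X Y x) (Z x) + g x (Y x) (nabla X Z x).

Definition levi_civita U g nabla : Prop :=
  [/\ affine_connection U nabla, torsion_free U nabla
    & metric_compatible U g nabla].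

End LeviCivita.

(** The normed space Sym(n), with the norm induced by that of matrices. *)

Record sym (R : realType) (n : nat) := Sym {
  mx_of_sym :> 'M[R]_n;
  _ : mx_of_sym \is symmetricmx }.

Lemma symmetricmxE (R : realType) n (A : 'M[R]_n) :
  (A \is symmetricmx) = (A^T == A).
Proof. by rewrite is_hermitianmxE expr0 scale1r map_mx_id // eq_sym. Qed.

Section SymNormed.
Variables (R : realType) (n : nat).

HB.instance Definition _ := [isSub of sym R n for @mx_of_sym R n].
HB.instance Definition _ := [Choice of sym R n by <:].

Fact symmetricmx_submod_closed :
  subsemimod_closed [pred A : 'M[R]_n | A \is symmetricmx].
Proof.
split; [split => [|A B]|move=> a A]; rewrite !inE !symmetricmxE.
- by rewrite trmx0.
- by move=> /eqP AT /eqP BT; rewrite linearD /= AT BT.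
- by move=> /eqP AT; rewrite linearZ /= AT.
Qed.

HB.instance Definition _ :=
  GRing.SubChoice_isSubLmodule.Build R 'M[R]_n _ (sym R n)
    symmetricmx_submod_closed.

Definition sym_norm (A : sym R n) : R := `|mx_of_sym A|.

Fact ler_sym_normD A B : sym_norm (A + B) <= sym_norm A + sym_norm B.
Proof. exact: ler_normD. Qed.

Fact sym_normZ (a : R) A : sym_norm (a *: A) = `|a| * sym_norm A.
Proof. exact: normrZ. Qed.

Fact sym_norm0_eq0 A : sym_norm A = 0 -> A = 0.
Proof. by move=> /normr0_eq0 A0; exact: val_inj. Qed.

HB.instance Definition _ :=
  @Lmodule_isNormed.Build R (sym R n) sym_norm ler_sym_normD sym_normZ
    sym_norm0_eq0.

End SymNormed.

Section BuresWasserstein.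
Variables (R : realType) (n : nat).
Implicit Types S X Y : sym R n.

Definition spd : set (sym R n) :=
  [set S | forall v : 'cV[R]_n, v != 0 -> 0 < (v^T *m S *m v) 0 0].

(* The set contains one value per spectral decomposition [S = P D P^T]; on SPD
   matrices all of them coincide, so that [get] returns the common value. *)
Definition bw_quad S X : R :=
  get [set q | exists (P : 'M[R]_n) (d : 'rV[R]_n),
    [/\ P^T *m P = 1%:M,
        S = P *m diag_mx d *m P^T :> 'M[R]_n
      & q = 2^-1 * \sum_i \sum_j
              (d 0 i + d 0 j)^-1 * (P^T *m X *m P) i j ^+ 2]].

(* The bilinear form is obtained from the quadratic form by polarization. *)
Definition bw_metric S X Y : R :=
  2^-1 * (bw_quad S (X + Y) - bw_quad S X - bw_quad S Y).

(* [Z] is a symmetric solution X^0 of the equation X = S X^0 + X^0 S. *)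
Definition lyapunov_sol S X (Z : sym R n) : Prop :=
  X = S *m Z + Z *m S :> 'M[R]_n.

End BuresWasserstein.

Arguments spd {R n}.
Arguments bw_metric {R n}.

(* Main.v *)
Require Import Defs.
From HB Require Import structures.
From mathcomp Require Import all_boot all_order all_algebra.
From mathcomp Require Import all_classical all_reals all_analysis.
From mathcomp Require Import complex ring lra.
Import Order.TTheory GRing.Theory Num.Theory.
Import numFieldNormedType.Exports.
Local Open Scope classical_set_scope.
Local Open Scope ring_scope.

Set Implicit Arguments.
Unset Strict Implicit.
Unset Printing Implicit Defensive.

(** Diagonalizing [S] turns the Bures-Wasserstein quadratic form into
    [g_S(X, Y) = 1/2 tr (X Y^0)], and the Lyapunov operator [Z |-> S Z + Z S] is
    self-adjoint for the trace form and positive when [S] is SPD. By Cramer's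
    rule its inverse depends smoothly on [S]. Differentiating
    [Z = S Z^0 + Z^0 S] along [X] gives
    [S dZ^0 + dZ^0 S = dZ - (X Z^0 + Z^0 X)]; with this and cyclicity of the trace
    the connection [\partial_X Y - (X^0 S Y^0 + Y^0 S X^0)] is compatible with
    [g], and it is torsion-free because the correction term is symmetric.
    The difference of two Levi-Civita connections, lowered with [g], is symmetric
    in its first two arguments and antisymmetric in its last two, so it
    vanishes. *)

(** * Spectral theorem for real symmetric matrices *)

(** Over [R[i]] the matrix is Hermitian, so the complex spectral theorem gives it a real eigenvalue.
    That eigenvalue is a root of the characteristic polynomial, which has real coefficients, so it
    is an eigenvalue over [R] too. *)
Lemma symmetric_eigenvector (R : rcfType) n (A : 'M[R]_n.+1) : A^T = A ->
  exists a (v : 'rV[R]_n.+1), v != 0 /\ v *m A = a *: v.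
Proof.
move=> AT.
pose f := real_complex R.
pose B : 'M[R[i]]_n.+1 := map_mx f A.
have freal (x : R) : (f x)^* = f x by apply/conj_Creal; rewrite complex_real.
have Bherm : B \is hermsymmx.
  apply/is_hermitianmxP; rewrite expr0 scale1r; apply/matrixP => i j.
  by rewrite !mxE freal -[in LHS]AT mxE.
have /hermitian_normalmx/orthomx_spectralP BE := Bherm.
have sr := hermitian_spectral_diag_real Bherm.
set P := spectralmx B in BE; set d := spectral_diag B in BE sr.
have Pu : P \in unitmx := spectral_unit B.
(* The first row of the invertible matrix [P] is a left eigenvector, nonzero because
   [P *m invmx P = 1]. *)
have eB : eigenvalue B (d 0 0).
  apply/eigenvalueP; exists (row 0 P).
    rewrite -row_mul {1}BE !mulmxA mulmxV // mul1mx row_mul.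
    by rewrite row_diag_mx -scalemxAl -rowE.
  apply/eqP => P0; have /rowP/(_ 0)/eqP : row 0 (P *m invmx P) = 0.
    by rewrite row_mul P0 mul0mx.
  by rewrite mulmxV // !mxE oner_eq0.
have /RRe_real dE : d 0 0 \is Num.real by apply/mxOverP.
rewrite eigenvalue_root_char -dE in eB.
rewrite -map_char_poly fmorph_root -eigenvalue_root_char in eB.
by have /eigenvalueP[v vA v0] := eB; exists (complex.Re (d 0 0)), v.
Qed.

(** With [u = v / |v|], [e] the first basis vector and [w = u - e], the reflection
    [1 - (2 / |w|^2) w^T w] exchanges [e] and [u], so its first row is [u]. *)
Lemma householder (R : rcfType) n (v : 'rV[R]_n.+1) : v != 0 ->
  exists (H : 'M[R]_n.+1) c, [/\ H^T = H, H *m H = 1%:M, c != 0 & row 0 H = c *: v].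
Proof.
move=> v0.
have dotE (u w : 'rV[R]_n.+1) : (u *m w^T) = (\sum_i u 0 i * w 0 i)%:M.
  by apply/matrixP => i j; rewrite !ord1 !mxE eqxx; apply: eq_bigr => k _; rewrite mxE.
have dotgt0 (u : 'rV[R]_n.+1) : u != 0 -> 0 < \sum_i u 0 i * u 0 i.
  move=> /rV0Pn[i ui]; rewrite (bigD1 i) //= ltr_pwDl //.
    by rewrite -expr2 exprn_even_gt0.
  by apply: sumr_ge0 => j _; rewrite -expr2 sqr_ge0.
pose s := \sum_i v 0 i * v 0 i.
have s0 : 0 < s by apply: dotgt0.
pose c := (Num.sqrt s)^-1.
have c0 : c != 0 by rewrite invr_eq0 gt_eqF // sqrtr_gt0.
pose e : 'rV[R]_n.+1 := delta_mx 0 0.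
pose u := c *: v.
have uu : u *m u^T = 1%:M.
  rewrite linearZ /= -scalemxAl -scalemxAr dotE -/s scalerA scale_scalar_mx.
  by rewrite /c -expr2 exprVn sqr_sqrtr ?ltW // mulVf // gt_eqF.
(* If [u = e] then [w = 0] and the reflection is undefined; the identity does the job. *)
have [ue|/eqP w0] := eqVneq u e.
  by exists 1%:M, c; rewrite trmx1 mulmx1 row1 -/e -ue.
have [w wE] : exists w, w = u - e by exists (u - e).
have {}w0 : w != 0 by rewrite wE subr_eq0; apply/eqP.
pose k := \sum_i w 0 i * w 0 i.
have k0 : 0 < k by apply: dotgt0.
have kE : w *m w^T = k%:M by rewrite dotE.
have ew : e *m w^T = (u 0 0 - 1)%:M.
  rewrite -rowE wE; apply/matrixP => i j.
  by rewrite !ord1 !mxE eqxx.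
(* Both [u] and [e] are unit vectors, so [|u - e|^2 = 2 - 2 <u, e>]; this makes the coefficient of
   [w] in [e H] equal to 1. *)
have k2 : k = 2 * (1 - u 0 0).
  have : (w *m w^T) 0 0 = 2 * (1 - u 0 0).
    rewrite {1}wE mulmxBl ew wE linearB /= mulmxBr uu.
    rewrite trmx_delta -colE !mxE eqxx.
    by rewrite /= !mulr1n; ring.
  by rewrite kE mxE eqxx.
pose H := 1%:M - (2 / k) *: (w^T *m w).
exists H, c; split => //.
- by rewrite /H linearB /= linearZ /= trmx1 trmx_mul trmxK.
- rewrite /H mulmxBl mul1mx mulmxBr mulmx1 -scalemxAl -!scalemxAr.
  rewrite -mulmxA (mulmxA w) kE mul_scalar_mx -!scalemxAr !scalerA.
  rewrite -scalerBl -addrA -opprD -scalerDl.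
  suff -> : 2 / k + (2 / k - 2 / k * (2 / k * k)) = 0 by rewrite scale0r subr0.
  by field; rewrite gt_eqF.
- rewrite rowE -/e /H mulmxBr mulmx1 -scalemxAr mulmxA ew mul_scalar_mx scalerA.
  have -> : 2 / k * (u 0 0 - 1) = -1.
    have k00 : k != 0 by rewrite gt_eqF.
    by rewrite k2 in k00 *; field; move: k00; rewrite mulf_eq0 negb_or => /andP[].
  by rewrite scaleN1r opprK wE addrC subrK.
Qed.

(* A Householder reflection sending the first basis vector to a unit eigenvector
   splits off a 1 x 1 block. *)
Lemma symmetric_spectral (R : rcfType) n (A : 'M[R]_n) : A^T = A ->
  exists (P : 'M[R]_n) (d : 'rV[R]_n), P^T *m P = 1%:M /\ A = P *m diag_mx d *m P^T.
Proof.
elim: n A => [|n IH] A AT.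
  by exists 1%:M, 0; rewrite trmx1 mulmx1; split => //; apply/matrixP => -[].
have [a [v [v0 vA]]] := symmetric_eigenvector AT.
have [H [c [HT HH c0 Hv]]] := householder v0.
(* [B] is made opaque: [mxE] would look through a local definition. *)
have [B BE0] : exists B, B = H *m A *m H by exists (H *m A *m H).
have BT : B^T = B by rewrite BE0 !trmx_mul HT AT mulmxA.
(* The first row of [H] is a multiple of the eigenvector [v], so multiplying by [A] scales it by
   [a], and [H *m H = 1] sends it back to the first basis vector. *)
have B0 : row 0 B = a *: delta_mx 0 0 :> 'rV[R]_n.+1.
  rewrite BE0 row_mul row_mul Hv -scalemxAl vA scalerA mulrC -scalerA -Hv.
  by rewrite -scalemxAl -row_mul HH row1.
have B0i i : B 0 i = a *+ (i == 0).
  by have /rowP/(_ i) := B0; rewrite !mxE eqxx mulr_natr.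
pose C : 'M[R]_n := drsubmx (B : 'M[R]_(1 + n)).
have CT : C^T = C by rewrite /C -[in RHS]BT trmx_drsub.
have l0 (i : 'I_1) : lshift n i = 0 :> 'I_n.+1.
  by apply/val_inj; rewrite /= ord1.
have BE : B = block_mx a%:M 0 0 C :> 'M[R]_(1 + n).
  rewrite -[LHS](@submxK _ 1 n 1 n) -/C; congr block_mx.
  - by apply/matrixP => i j; rewrite !mxE !l0 B0i !ord1 eqxx.
  - by apply/matrixP => i j; rewrite !mxE !l0 B0i.
  - by apply/matrixP => i j; rewrite !mxE !l0 -BT mxE B0i.
have [P [d [PP CE]]] := IH C CT.
pose Q : 'M[R]_(1 + n) := block_mx 1%:M 0 0 P.
have QT : Q^T = block_mx 1%:M 0 0 P^T by rewrite tr_block_mx !trmx0 trmx1.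
have QQ : Q^T *m Q = 1%:M.
  rewrite QT mulmx_block PP !mulmx0 !mul0mx !addr0 !add0r mulmx1.
  by rewrite -scalar_mx_block.
have da : diag_mx (a%:M : 'M[R]_1) = a%:M.
  by apply/matrixP => i j; rewrite !ord1 !mxE.
have BQ : B = Q *m diag_mx (row_mx a%:M d) *m Q^T.
  rewrite QT BE CE diag_mx_row !mulmx_block.
  rewrite !(mulmx0, mul0mx, addr0, add0r, mulmx1, mul1mx).
  by rewrite da.
have -> : A = H *m B *m H by rewrite BE0 !mulmxA HH mul1mx -mulmxA HH mulmx1.
exists (H *m Q), (row_mx a%:M d); rewrite trmx_mul HT; split.
  by rewrite mulmxA -(mulmxA _ H H) HH mulmx1.
by rewrite BQ !mulmxA.
Qed.

(** * Smoothness calculus *)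

(** Locality of the differential: the first-order expansion of [f] at [x] is also one for [g], and
    the linear part of such an expansion is unique. *)
Lemma near_eq_diff (R : realType) (V W : normedModType R) (f g : V -> W) (x : V) :
  (\forall y \near x, f y = g y) -> differentiable f x ->
  differentiable g x /\ 'd g x = 'd f x :> (V -> W).
Proof.
move=> fg df.
have gE : g \o shift x = cst (g x) + 'd f x +o_ (0 : V) id.
  have /eqaddoP fE := diff_locally df.
  apply/eqaddoP => e e0.
  move: fg; rewrite (near_shift 0) subr0 => fg.
  have fgx : f x = g x by have := nbhs_singleton fg; rewrite /= add0r.
  by apply: filterS2 fg (fE e e0) => h; rewrite /= !fctE /= fgx => ->.
have dg : 'd g x = 'd f x :> (V -> W) by apply: diff_unique => //; exact: diff_continuous.
split=> //; apply/diff_locallyP; rewrite dg; split=> //; exact: diff_continuous.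
Qed.

Section Ck.
Context {R : realType} {V : normedModType R} (U : set V).
Context (Uo : open U).

(** Permits replacing a map by a formula valid only on [U]: as [U] is open, equality on [U] is
    equality near each of its points, which passes to all derivatives. *)
Lemma Ck_on_eq (W : normedModType R) k (f g : V -> W) :
  (forall x, U x -> f x = g x) -> Ck_on U k f -> Ck_on U k g.
Proof.
have near_fg (h1 h2 : V -> W) x : U x -> (forall x, U x -> h1 x = h2 x) ->
    \forall y \near x, h1 y = h2 y.
  by move=> Ux h; apply: filterS (open_nbhs_nbhs (conj Uo Ux)) => y /h.
elim: k f g => [|k IH] f g fg /=.
  move=> cf x Ux; have := cf x Ux; rewrite /prop_for /continuous_at (fg _ Ux).
  by apply: cvg_trans; apply: near_eq_cvg; apply: near_fg Ux _ => y Uy; rewrite fg.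
move=> [df ck]; split=> [x Ux|v].
  by have [] := near_eq_diff (near_fg _ _ _ Ux fg) (df x Ux).
apply: IH (ck v) => x Ux.
by have [_ ->] := near_eq_diff (near_fg _ _ _ Ux fg) (df x Ux).
Qed.

Lemma Ck_on_pred (W : normedModType R) k (f : V -> W) :
  Ck_on U k.+1 f -> Ck_on U k f.
Proof.
elim: k f => [|k IH] f /= [df ck].
  by move=> x Ux; apply: differentiable_continuous; exact: df.
by split=> // v; apply: IH; exact: ck.
Qed.

Lemma Ck_on_cst (W : normedModType R) k (a : W) : Ck_on U k (fun=> a).
Proof.
elim: k a => [|k IH] a /=; first by move=> x _; apply: cst_continuous.
split=> [x _|v]; first exact: differentiable_cst.
by apply: Ck_on_eq (IH 0) => x _; rewrite diff_cst.
Qed.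

Lemma Ck_on_add (W : normedModType R) k (f g : V -> W) :
  Ck_on U k f -> Ck_on U k g -> Ck_on U k (fun x => f x + g x).
Proof.
elim: k f g => [|k IH] f g /=.
  by move=> cf cg x Ux; apply: continuousD; [exact: cf|exact: cg].
move=> [df ckf] [dg ckg]; split=> [x Ux|v].
  by apply: differentiableD; [exact: df|exact: dg].
apply: Ck_on_eq (IH _ _ (ckf v) (ckg v)) => x Ux.
by rewrite [in RHS](@diffD _ _ _ f g) //; [exact: df|exact: dg].
Qed.

Lemma Ck_on_sum (W : normedModType R) k (I : Type) (r : seq I) (P : pred I)
    (f : I -> V -> W) :
  (forall i, Ck_on U k (f i)) -> Ck_on U k (fun x => \sum_(i <- r | P i) f i x).
Proof.
move=> cf; elim: r => [|i r IH].
  by under eq_fun do rewrite big_nil; exact: Ck_on_cst.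
under eq_fun do rewrite big_cons.
by case: (P i) => //; exact: Ck_on_add.
Qed.

Lemma Ck_on_linear_comp (W W' : normedModType R) (l : {linear W -> W'}) k
    (f : V -> W) :
  continuous l -> Ck_on U k f -> Ck_on U k (fun x => l (f x)).
Proof.
move=> cl; elim: k f => [|k IH] f /=.
  by move=> cf x Ux; apply: continuous_comp; [exact: cf|exact: cl].
move=> [df ckf]; split=> [x Ux|v].
  by apply: differentiable_comp; [exact: df|exact: linear_differentiable].
apply: Ck_on_eq (IH _ (ckf v)) => x Ux.
rewrite [in RHS](@diff_comp _ _ _ _ f l) //; last exact: linear_differentiable.
  by rewrite diff_lin.
exact: df.
Qed.

Lemma Ck_on_linear (W : normedModType R) (l : {linear V -> W}) k :
  continuous l -> Ck_on U k l.
Proof.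
move=> cl; case: k => [|k] /=; first by move=> x _; exact: cl.
split=> [x _|v]; first exact: linear_differentiable.
by apply: Ck_on_eq (Ck_on_cst _ (l v)) => x _; rewrite diff_lin.
Qed.

(** Induction through the Leibniz rule, whose terms contain [f] and [g] themselves; [Ck_on_pred]
    lowers these to the order of the induction hypothesis. *)
Lemma Ck_on_mul k (f g : V -> R) :
  Ck_on U k f -> Ck_on U k g -> Ck_on U k (fun x => f x * g x).
Proof.
elim: k f g => [|k IH] f g.
  by move=> /= cf cg x Ux; apply: continuousM; [exact: cf|exact: cg].
move=> kf kg; have [/= df ckf] := kf; have [/= dg ckg] := kg.
split=> [x Ux|v].
  by apply: differentiableM; [exact: df|exact: dg].
have := Ck_on_add (IH _ _ (Ck_on_pred kf) (ckg v))
   (IH _ _ (Ck_on_pred kg) (ckf v)).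
by apply: Ck_on_eq => x Ux; rewrite [in RHS]diffM //; [exact: df|exact: dg].
Qed.

(** The derivative is [- f^-2 df], in which [f^-1] is C^k by induction. *)
Lemma Ck_on_inv k (f : V -> R) :
  (forall x, U x -> f x != 0) -> Ck_on U k f -> Ck_on U k (fun x => (f x)^-1).
Proof.
move=> f0; elim: k => [|k IH].
  by move=> /= cf x Ux; apply: continuousV; [exact: f0|exact: cf].
move=> kf; have [/= df ckf] := kf.
split=> [x Ux|v].
  by apply: differentiableV; [exact: df|exact: f0].
have kV := IH (Ck_on_pred kf).
have := Ck_on_mul (Ck_on_cst k (-1 : R))
  (Ck_on_mul (Ck_on_mul kV kV) (ckf v)).
apply: Ck_on_eq => x Ux; rewrite [in RHS]diffV //; [|exact: df|exact: f0].
by rewrite /= mulN1r -mulNr -exprVn expr2.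
Qed.

Lemma Ck_on_prod k (I : Type) (r : seq I) (f : I -> V -> R) :
  (forall i, Ck_on U k (f i)) -> Ck_on U k (fun x => \prod_(i <- r) f i x).
Proof.
move=> cf; elim: r => [|i r IH].
  by under eq_fun do rewrite big_nil; exact: Ck_on_cst.
by under eq_fun do rewrite big_cons; exact: Ck_on_mul.
Qed.

Lemma Ck_on_det k m (A : V -> 'M[R]_m) :
  (forall i j, Ck_on U k (fun x => A x i j)) -> Ck_on U k (fun x => \det (A x)).
Proof.
move=> cA; rewrite /determinant; apply: Ck_on_sum => s.
by apply: Ck_on_mul; [exact: Ck_on_cst|apply: Ck_on_prod => i].
Qed.

(** Cramer's rule: each entry of the inverse is a cofactor divided by the determinant. *)
Lemma Ck_on_invmx k m (A : V -> 'M[R]_m) :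
  (forall x, U x -> A x \in unitmx) ->
  (forall i j, Ck_on U k (fun x => A x i j)) ->
  forall i j, Ck_on U k (fun x => invmx (A x) i j).
Proof.
move=> uA cA i j.
apply: (@Ck_on_eq _ _ (fun x => (\det (A x))^-1 * cofactor (A x) j i)).
  by move=> x Ux; rewrite /invmx uA // !mxE.
apply: Ck_on_mul.
  apply: Ck_on_inv (Ck_on_det cA) => x Ux.
  by rewrite -unitfE -unitmxE uA.
apply: Ck_on_mul; first exact: Ck_on_cst.
by apply: Ck_on_det => a b; under eq_fun do rewrite !mxE; exact: cA.
Qed.

End Ck.

(** * The space of symmetric matrices *)

Section Sym.
Context {R : realType} {n : nat}.
Implicit Types (A B : sym R n) (M : 'M[R]_n).

Lemma trmx_sym A : (A : 'M[R]_n)^T = A.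
Proof. by case: A => A /= AT; apply/eqP; rewrite -symmetricmxE. Qed.

Lemma sym_mxP A B : (A : 'M[R]_n) = B -> A = B.
Proof. by move=> AB; apply: val_inj. Qed.

Lemma sym_mxD A B : (A + B : sym R n) = (A : 'M[R]_n) + B :> 'M[R]_n.
Proof. by []. Qed.

Lemma sym_mxZ (a : R) A : (a *: A : sym R n) = a *: (A : 'M[R]_n) :> 'M[R]_n.
Proof. by []. Qed.

Lemma sym_mxB A B : (A - B : sym R n) = (A : 'M[R]_n) - (B : 'M[R]_n) :> 'M[R]_n.
Proof. by []. Qed.

Lemma sym_mx_sum (I : Type) (r : seq I) (F : I -> sym R n) :
  (\sum_(i <- r) F i : sym R n) = \sum_(i <- r) (F i : 'M[R]_n) :> 'M[R]_n.
Proof. by elim/big_ind2 : _ => // A B C D <- <-. Qed.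

Fact symz_subproof M : M + M^T \is symmetricmx.
Proof. by rewrite symmetricmxE linearD /= trmxK addrC. Qed.

(** Twice the symmetric part, as an element of [sym R n]. Leaving out the factor 1/2 gives it the
    shape of the correction term of the connection. *)
Definition symz M : sym R n := Sym (symz_subproof M).

Lemma symzE M : symz M = M + M^T :> 'M[R]_n.
Proof. by []. Qed.

Definition sym_coord (i j : 'I_n) A : R := A i j.

Fact sym_coord_linear i j : linear (sym_coord i j).
Proof. by move=> a A B; rewrite /sym_coord sym_mxD sym_mxZ !mxE. Qed.

HB.instance Definition _ i j :=
  GRing.isLinear.Build R (sym R n) R _ (sym_coord i j) (sym_coord_linear i j).

Lemma ler_sym_coord i j A : `|A i j| <= `|A|.
Proof.
rewrite [leRHS]mx_normrE.
exact: (le_bigmax _ (fun ij => `|A ij.1 ij.2|) (i, j)).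
Qed.

Lemma sym_coord_continuous i j : continuous (sym_coord i j).
Proof.
apply/linear_bounded_continuous/bounded_funP => r.
by exists r => A; apply: le_trans; exact: ler_sym_coord.
Qed.

(** A spanning family indexed by all pairs, with [sym_delta i j = sym_delta j i]; this avoids
    ordering the indices as a basis would require. *)
Definition sym_delta (i j : 'I_n) : sym R n :=
  2^-1 *: symz (delta_mx i j).

Lemma sym_decomp A : A = \sum_i \sum_j A i j *: sym_delta i j.
Proof.
have deltaE i j : (A i j *: sym_delta i j : 'M[R]_n) =
    2^-1 *: (A i j *: delta_mx i j + A i j *: delta_mx j i).
  rewrite sym_mxZ sym_mxZ symzE trmx_delta.
  by rewrite scalerA mulrC -scalerA scalerDr.
apply: sym_mxP; rewrite sym_mx_sum.
under eq_bigr => i _.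
  rewrite sym_mx_sum; under eq_bigr do rewrite deltaE.
  rewrite -scaler_sumr big_split /=; over.
rewrite -scaler_sumr big_split /= -matrix_sum_delta.
have -> : \sum_i \sum_j A i j *: delta_mx j i = A :> 'M[R]_n.
  rewrite exchange_big /= [RHS]matrix_sum_delta; apply: eq_bigr => i _.
  by apply: eq_bigr => j _; rewrite -[in LHS]trmx_sym mxE.
by rewrite scalerDr -scalerDl (_ : _ + _ = 1) ?scale1r //; lra.
Qed.

End Sym.

Section CkSym.
Context {R : realType} {n : nat} {V : normedModType R} (U : set V).
Context (Uo : open U).

(** Coordinates are continuous linear maps; conversely [sym_decomp] rebuilds [F] as a finite sum of
    its coordinates times constant matrices. *)
Lemma Ck_on_symP k (F : V -> sym R n) :
  Ck_on U k F <-> forall i j, Ck_on U k (fun x => F x i j : R).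
Proof.
split=> [cF i j|cF].
  by apply: (Ck_on_linear_comp Uo (l := sym_coord i j) _ cF); exact: sym_coord_continuous.
have -> : F = fun x => \sum_i \sum_j F x i j *: sym_delta i j.
  by apply/funext => x; exact: sym_decomp.
apply: Ck_on_sum => // i; apply: Ck_on_sum => // j.
have lin : linear (fun a : R => a *: sym_delta i j).
  by move=> a x y; rewrite scalerDl; congr (_ + _); exact/esym/scalerA.
pose linM := GRing.isLinear.Build _ _ _ _ _ lin.
pose l : {linear R -> sym R n} := HB.pack (fun a : R => a *: sym_delta i j) linM.
apply: (Ck_on_linear_comp Uo (l := l) _ (cF i j)).
exact: scalel_continuous.
Qed.

Lemma diff_sym_coord (F : V -> sym R n) (x v : V) i j : differentiable F x ->
  'd (fun y => F y i j : R) x v = 'd F x v i j.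
Proof.
move=> dF; rewrite [LHS](_ : _ = 'd (sym_coord i j \o F) x v) //.
rewrite diff_comp //; last exact/linear_differentiable/sym_coord_continuous.
by rewrite diff_lin //; exact: sym_coord_continuous.
Qed.

Lemma differentiable_sym_coord (F : V -> sym R n) (x : V) i j :
  differentiable F x -> differentiable (fun y => F y i j : R) x.
Proof.
move=> dF; apply: (@differentiable_comp _ _ _ _ F (sym_coord i j)) => //.
exact/linear_differentiable/sym_coord_continuous.
Qed.

End CkSym.

(** * The Lyapunov operator and the metric *)

Section Lyapunov.
Context {R : realType} {n : nat}.
Implicit Types (S X Y Z : sym R n) (M A B : 'M[R]_n).

Lemma mxtrace_congr M S :
  \tr (M^T *m S *m M) = \sum_j ((col j M)^T *m S *m col j M) 0 0.
Proof.
apply: eq_bigr => j _.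
by rewrite tr_col -row_mul (colE j) mulmxA -colE -row_mul [RHS]mxE [RHS]mxE.
Qed.

Lemma spd_ge0 S (v : 'cV[R]_n) : spd S -> 0 <= (v^T *m S *m v) 0 0.
Proof.
move=> Sp; have [->|v0] := eqVneq v 0; first by rewrite mulmx0 mxE.
exact/ltW/Sp.
Qed.

Lemma spd_mxtrace_ge0 S M : spd S -> 0 <= \tr (M^T *m S *m M).
Proof. by move=> Sp; rewrite mxtrace_congr sumr_ge0 // => j _; exact: spd_ge0. Qed.

Lemma spd_mxtrace_eq0 S M : spd S -> \tr (M^T *m S *m M) = 0 -> M = 0.
Proof.
move=> Sp; rewrite mxtrace_congr => /eqP; rewrite psumr_eq0; last first.
  by move=> j _; exact: spd_ge0.
move=> /allP M0; apply/matrixP => i j; rewrite mxE.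
have [/colP/(_ i)|cj] := eqVneq (col j M) 0; first by rewrite !mxE.
by have := Sp _ cj; rewrite (eqP (M0 j _)) ?ltxx ?mem_index_enum.
Qed.

(** Pairing with [M^T] under the trace gives [tr (M^T S M) + tr (M S M^T) = 0], a sum of two
    nonnegative terms. [M] is an arbitrary square matrix here. *)
Lemma spd_lyapunov_inj S M : spd S -> S *m M + M *m S = 0 -> M = 0.
Proof.
move=> Sp SM.
have : \tr (M^T *m S *m M) + \tr (M^T^T *m S *m M^T) = 0.
  rewrite trmxK (mxtrace_mulC (M *m S)) -mulmxA -mxtraceD -mulmxDr SM.
  by rewrite mulmx0 mxtrace0.
move/eqP; rewrite paddr_eq0 ?spd_mxtrace_ge0 // => /andP[/eqP M0 _].
exact: spd_mxtrace_eq0 Sp M0.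
Qed.

(** Matrix of [M |-> A M + M A] acting on vectorized matrices, so that determinants and [invmx]
    apply to the Lyapunov operator. *)
Definition lyapunov_mx A := lin_mulmx A + lin_mulmxr A.

Lemma mul_vec_lyapunov_mx A M :
  mxvec M *m lyapunov_mx A = mxvec (A *m M + M *m A).
Proof. by rewrite mulmxDr !mul_vec_lin linearD. Qed.

Lemma spd_lyapunov_mx_unit S : spd S -> lyapunov_mx S \in unitmx.
Proof.
move=> Sp; rewrite -row_free_unit -kermx_eq0; apply/rowV0P => v /sub_kermxP.
rewrite -[v]vec_mxK mul_vec_lyapunov_mx => /eqP; rewrite mxvec_eq0 => /eqP vM.
by rewrite (spd_lyapunov_inj Sp vM) linear0.
Qed.

(* The symmetrization only serves to land in [sym R n]: on SPD matrices the
   solution found by inverting the Lyapunov operator on all matrices is already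
   symmetric. *)
Definition lyapunov_inv S X : sym R n :=
  2^-1 *: symz (vec_mx (mxvec X *m invmx (lyapunov_mx S))).

Lemma lyapunov_invP S X : spd S -> lyapunov_sol S X (lyapunov_inv S X).
Proof.
move=> Sp; pose Z := vec_mx (mxvec X *m invmx (lyapunov_mx S)).
have XZ : (X : 'M[R]_n) = S *m Z + Z *m S.
  apply: (can_inj mxvecK); rewrite -mul_vec_lyapunov_mx vec_mxK.
  by rewrite mulmxKV // spd_lyapunov_mx_unit.
(* Transposing the equation shows that [Z^T] solves it too, hence so does the average of [Z] and
   [Z^T]. *)
have XZT : (X : 'M[R]_n) = S *m Z^T + Z^T *m S.
  by rewrite -[LHS]trmx_sym XZ linearD /= !trmx_mul trmx_sym addrC.
rewrite /lyapunov_sol /lyapunov_inv sym_mxZ symzE -/Z.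
rewrite -scalemxAr -scalemxAl -scalerDr mulmxDr mulmxDl addrACA -XZ -XZT.
by rewrite scalerDr -scalerDl (_ : _ + _ = 1) ?scale1r //; lra.
Qed.

Lemma lyapunov_sol_unique S X Z : spd S -> lyapunov_sol S X Z ->
  lyapunov_inv S X = Z.
Proof.
move=> Sp XZ; apply/sym_mxP/subr0_eq/(spd_lyapunov_inj Sp).
rewrite mulmxBr mulmxBl addrACA -opprD -XZ.
by rewrite -(lyapunov_invP X Sp) subrr.
Qed.

Lemma lyapunov_invD S X Y : spd S ->
  lyapunov_inv S (X + Y) = lyapunov_inv S X + lyapunov_inv S Y.
Proof.
move=> Sp; apply: lyapunov_sol_unique => //.
rewrite /lyapunov_sol !sym_mxD mulmxDr mulmxDl addrACA.
by rewrite -!(lyapunov_invP _ Sp).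
Qed.

Lemma lyapunov_invZ S (a : R) X : spd S ->
  lyapunov_inv S (a *: X) = a *: lyapunov_inv S X.
Proof.
move=> Sp; apply: lyapunov_sol_unique => //.
rewrite /lyapunov_sol !sym_mxZ -scalemxAr -scalemxAl -scalerDr.
by rewrite -(lyapunov_invP _ Sp).
Qed.

Lemma lyapunov_selfadjoint A M N :
  \tr ((A *m M + M *m A) *m N) = \tr (M *m (A *m N + N *m A)).
Proof.
rewrite mulmxDl mulmxDr !mxtraceD addrC -!mulmxA; congr (_ + _).
by rewrite [LHS]mxtrace_mulC mulmxA.
Qed.

(** Symmetry of the metric, from self-adjointness of the Lyapunov operator. *)
Lemma mxtrace_lyapunov_invC S X Y : spd S ->
  \tr ((X : 'M[R]_n) *m lyapunov_inv S Y) = \tr ((Y : 'M[R]_n) *m lyapunov_inv S X).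
Proof.
move=> Sp; rewrite {1}(lyapunov_invP X Sp) lyapunov_selfadjoint.
by rewrite -(lyapunov_invP Y Sp) mxtrace_mulC.
Qed.

Lemma spd_diag_gt0 S (P : 'M[R]_n) (d : 'rV[R]_n) i : spd S ->
  P^T *m P = 1%:M -> S = P *m diag_mx d *m P^T :> 'M[R]_n -> 0 < d 0 i.
Proof.
move=> Sp PP SE.
(* The eigenvalue [d 0 i] is the value of the quadratic form of [S] at the [i]-th column of [P]. *)
have cP : (col i P)^T *m S *m col i P = (d 0 i)%:M.
  rewrite SE colE trmx_mul !mulmxA -(mulmxA _ P^T P) PP mulmx1.
  rewrite -(mulmxA _ P^T P) PP mulmx1 trmx_delta -rowE row_diag_mx -scalemxAl.
  rewrite mul_delta_mx -scalemx1; congr (_ *: _).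
  by apply/matrixP => a b; rewrite !ord1 !mxE.
have := Sp (col i P); rewrite cP mxE eqxx mulr1n; apply.
apply/eqP => Pi0; have /matrixP/(_ i i)/eqP : P^T *m P = 1%:M by [].
suff -> : (P^T *m P) i i = 0 by rewrite mxE eqxx eq_sym oner_eq0.
rewrite mxE big1 // => k _; have /colP/(_ k) := Pi0; rewrite !mxE => ->.
by rewrite mulr0.
Qed.

(** In an eigenbasis of [S] the Lyapunov equation decouples into [X'_ij = (d_i + d_j) Z'_ij], so
    each summand is [X'_ij Z'_ij] and the sum is [tr (X' Z')], which equals [tr (X Z)] by orthogonal
    invariance. *)
Lemma bw_quad_spectral S X (P : 'M[R]_n) (d : 'rV[R]_n) : spd S ->
  P^T *m P = 1%:M -> S = P *m diag_mx d *m P^T :> 'M[R]_n ->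
  \sum_i \sum_j (d 0 i + d 0 j)^-1 * (P^T *m X *m P) i j ^+ 2
    = \tr ((X : 'M[R]_n) *m lyapunov_inv S X).
Proof.
move=> Sp PP SE; have PPT := mulmx1C PP.
have d0 i : 0 < d 0 i := spd_diag_gt0 i Sp PP SE.
set Z := lyapunov_inv S X.
pose X' := P^T *m X *m P; pose Z' := P^T *m Z *m P.
have Z'tr : Z'^T = Z' by rewrite /Z' !trmx_mul trmxK trmx_sym mulmxA.
have Z'T i j : Z' j i = Z' i j by rewrite -[in RHS]Z'tr [RHS]mxE.
have X'E : X' = diag_mx d *m Z' + Z' *m diag_mx d.
  rewrite /X' (lyapunov_invP X Sp) -/Z SE mulmxDr mulmxDl /Z' !mulmxA PP mul1mx.
  by congr (_ + _); rewrite -!mulmxA PP mulmx1.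
have X'ij i j : X' i j = (d 0 i + d 0 j) * Z' i j.
  by rewrite X'E mxE mul_diag_mx mul_mx_diag [X in X + _]mxE [X in _ + X]mxE; ring.
have -> : \tr ((X : 'M[R]_n) *m Z) = \tr (X' *m Z').
  rewrite /X' /Z' -!mulmxA (mulmxA P P^T) PPT mul1mx [RHS]mxtrace_mulC.
  by rewrite -!mulmxA PPT mulmx1.
apply: eq_bigr => i _; rewrite mxE; apply: eq_bigr => j _.
have dij : d 0 i + d 0 j != 0 by rewrite gt_eqF // addr_gt0.
by rewrite -/X' Z'T X'ij; field.
Qed.

(** Every spectral decomposition yields the same trace, and one exists by [symmetric_spectral], so
    [get] does not fall back on its default value. *)
Lemma bw_quadE S X : spd S ->
  bw_quad S X = 2^-1 * \tr ((X : 'M[R]_n) *m lyapunov_inv S X).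
Proof.
move=> Sp; rewrite /bw_quad; case: xgetP => [q _ [P [d [PP SE ->]]]|].
  by rewrite (bw_quad_spectral X Sp PP SE).
have [P [d [PP SE]]] := symmetric_spectral (trmx_sym S).
by move=> /(_ _ (ex_intro _ P (ex_intro _ d (And3 PP SE erefl)))).
Qed.

Lemma bw_metricE S X Y : spd S ->
  bw_metric S X Y = 2^-1 * \tr ((X : 'M[R]_n) *m lyapunov_inv S Y).
Proof.
move=> Sp; rewrite /bw_metric !bw_quadE // lyapunov_invD // !sym_mxD.
rewrite mulmxDl !mulmxDr !mxtraceD (mxtrace_lyapunov_invC Y X Sp).
lra.
Qed.

End Lyapunov.

(** * Openness of SPD(n) and smoothness of the Lyapunov inverse *)

Section SPD.
Context {R : realType} {n : nat}.
Implicit Types (S X Y Z : sym R n) (v : 'cV[R]_n).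

Lemma quad_formE (A : 'M[R]_n) v :
  (v^T *m A *m v) 0 0 = \sum_i \sum_j v i 0 * A i j * v j 0.
Proof.
rewrite mxE exchange_big /=; apply: eq_bigr => j _.
by rewrite mxE mulr_suml; apply: eq_bigr => i _; rewrite mxE.
Qed.

Lemma sqnormE v : (v^T *m v) 0 0 = \sum_i v i 0 ^+ 2.
Proof. by rewrite mxE; apply: eq_bigr => i _; rewrite mxE expr2. Qed.

Lemma sqnorm_gt0 v : v != 0 -> 0 < (v^T *m v) 0 0.
Proof.
rewrite sqnormE => /cV0Pn[i vi]; rewrite (bigD1 i) //= ltr_pwDl //.
  by rewrite exprn_even_gt0.
by apply: sumr_ge0 => j _; rewrite sqr_ge0.
Qed.

(** Each entry of [X] is at most its norm and [|v_i v_j| <= v_i^2 + v_j^2]; summing over all pairs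
    gives the factor [2 n]. *)
Lemma quad_form_le X v :
  (v^T *m X *m v) 0 0 <= `|X| * (2 * n%:R * (v^T *m v) 0 0).
Proof.
rewrite quad_formE sqnormE.
have -> : 2 * n%:R * (\sum_i v i 0 ^+ 2) = \sum_i \sum_j (v i 0 ^+ 2 + v j 0 ^+ 2).
  under [RHS]eq_bigr do rewrite big_split /= sumr_const card_ord.
  by rewrite big_split /= sumr_const card_ord sumrMnl -mulr_natl; ring.
rewrite mulr_sumr; apply: ler_sum => i _; rewrite mulr_sumr; apply: ler_sum => j _.
apply: le_trans (ler_norm _) _; rewrite !normrM mulrAC mulrC.
apply: ler_pM; rewrite ?mulr_ge0 ?ler_sym_coord //.
rewrite -(real_normK (num_real (v i 0))) -(real_normK (num_real (v j 0))).
by nra.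
Qed.

Lemma spd_coercive S : spd S ->
  exists2 m, 0 < m & forall v, m * (v^T *m v) 0 0 <= (v^T *m S *m v) 0 0.
Proof.
move=> Sp; have [P [d [PP SE]]] := symmetric_spectral (trmx_sym S).
have d0 i : 0 < d 0 i := spd_diag_gt0 i Sp PP SE.
(* The least eigenvalue, capped at 1; the cap also supplies a positive value when [n = 0]. *)
exists (\big[Order.min/1]_i d 0 i) => [|v].
  by elim/big_ind : _ => // x y x0 y0; rewrite lt_min x0.
have -> : v^T *m v = (P^T *m v)^T *m (P^T *m v).
  by rewrite trmx_mul trmxK mulmxA -(mulmxA _ P) (mulmx1C PP) mulmx1.
have -> : v^T *m S *m v = (P^T *m v)^T *m diag_mx d *m (P^T *m v).
  by rewrite SE trmx_mul trmxK !mulmxA.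
rewrite sqnormE [leRHS]mxE mulr_sumr; apply: ler_sum => i _.
rewrite mul_mx_diag [in leRHS]mxE [in leRHS]mxE.
rewrite mulrAC -expr2 mulrC ler_wpM2l ?sqr_ge0 //.
exact: bigmin_le_cond.
Qed.

Lemma open_spd : open (@spd R n).
Proof.
rewrite openE => S Sp; have [m m0 mS] := spd_coercive Sp.
(* By [quad_form_le] a perturbation smaller than this radius changes the form by less than
   [m |v|^2]; the [+ 1] keeps the denominator positive when [n = 0]. *)
apply/nbhs_normP; exists (m / (2 * n%:R + 1)).
  by rewrite /= divr_gt0 // ltr_wpDl // mulr_ge0.
move=> T /= ST v v0; have q0 := sqnorm_gt0 v0.
have -> : (T : 'M[R]_n) = (S : 'M[R]_n) - (S - T : sym R n).
  by rewrite -[RHS]/((S : 'M[R]_n) - ((S : 'M[R]_n) - T)) opprB addrC subrK.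
rewrite mulmxBr mulmxBl [ltRHS]mxE [X in _ + X]mxE subr_gt0.
apply: le_lt_trans (quad_form_le _ _) _; apply: lt_le_trans (mS v).
rewrite mulrA ltr_pM2r //; move: ST; rewrite ltr_pdivlMr; last first.
  by rewrite ltr_wpDl // mulr_ge0.
apply: le_lt_trans; rewrite mulrDr mulr1 lerDl; exact: normr_ge0.
Qed.

(** Shows the entries to be linear in those of [A] with constant coefficients, hence smooth in
    [A]. *)
Lemma lyapunov_mxE (A : 'M[R]_n) p i j :
  lyapunov_mx A p (mxvec_index i j) =
  \sum_l A i l * vec_mx (delta_mx 0 p) l j +
  \sum_l vec_mx (delta_mx 0 p) i l * A l j.
Proof.
rewrite mxE [X in X + _ = _]mxE [X in _ + X = _]mxE /= !mxvecE.
by rewrite [X in X + _ = _]mxE [X in _ + X = _]mxE.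
Qed.

Lemma Ck_on_lyapunov_inv k (F : sym R n -> sym R n) :
  Ck_on spd k F -> Ck_on spd k (fun S => lyapunov_inv S (F S)).
Proof.
have id_coord i j : Ck_on spd k (fun S : sym R n => S i j : R).
  apply: (Ck_on_linear open_spd (l := sym_coord i j)).
  exact: sym_coord_continuous.
move=> /(Ck_on_symP open_spd) cF; apply/(Ck_on_symP open_spd) => i j.
have cZ a b : Ck_on spd k (fun S : sym R n =>
   (vec_mx (mxvec (F S) *m invmx (lyapunov_mx S))) a b : R).
  under eq_fun do rewrite mxE mxE.
  apply: (Ck_on_sum open_spd) => c; apply: (Ck_on_mul open_spd).
    by case/mxvec_indexP: c => a' b'; under eq_fun do rewrite mxvecE; exact: cF.
  apply: (Ck_on_invmx open_spd); first exact: spd_lyapunov_mx_unit.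
  move=> p q; case/mxvec_indexP: q => a' b'.
  under eq_fun do rewrite lyapunov_mxE.
  apply: (Ck_on_add open_spd); apply: (Ck_on_sum open_spd) => l.
    by apply: (Ck_on_mul open_spd) => //; exact: (Ck_on_cst open_spd).
  by apply: (Ck_on_mul open_spd) => //; exact: (Ck_on_cst open_spd).
have c2 : Ck_on spd k (fun=> 2^-1 : R) := Ck_on_cst open_spd k (2^-1 : R).
apply: (Ck_on_eq open_spd) (Ck_on_mul open_spd c2
   (Ck_on_add open_spd (cZ i j) (cZ j i))) => S _.
by rewrite sym_mxZ symzE [RHS]mxE [X in _ = _ * X]mxE [X in _ = _ * (_ + X)]mxE.
Qed.

End SPD.

(** * The connection *)

Section DiffSum.
Context {R : realType} {V : normedModType R}.

Lemma diff_mul (f g : V -> R) (x v : V) : differentiable f x -> differentiable g x ->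
  'd (fun y => f y * g y) x v = 'd f x v * g x + f x * 'd g x v.
Proof.
move=> df dg; rewrite [LHS](congr1 (fun h => h v) (diffM df dg)).
by rewrite addrC mulrC.
Qed.

Lemma diff_sum (W : normedModType R) (I : Type) (r : seq I) (f : I -> V -> W) (x : V) :
  (forall i, differentiable (f i) x) ->
  differentiable (fun y => \sum_(i <- r) f i y) x /\
  forall v, 'd (fun y => \sum_(i <- r) f i y) x v = \sum_(i <- r) 'd (f i) x v.
Proof.
move=> df; elim: r => [|i r [dr IH]].
  under eq_fun do rewrite big_nil.
  split=> [|v]; first exact: differentiable_cst.
  by rewrite diff_cst big_nil.
under eq_fun do rewrite big_cons.
split=> [|v]; first exact: (@differentiableD _ _ _ (f i)).
by rewrite [LHS](congr1 (fun h => h v) (diffD (df i) dr)) big_cons -IH.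
Qed.

Context {n : nat}.
Implicit Types F G : V -> sym R n.

Lemma diff_mulmx F G x i j : differentiable F x -> differentiable G x ->
  differentiable (fun y => ((F y : 'M[R]_n) *m G y) i j : R) x /\
  forall v, 'd (fun y => ((F y : 'M[R]_n) *m G y) i j : R) x v =
    (('d F x v : 'M[R]_n) *m G x + (F x : 'M[R]_n) *m 'd G x v) i j.
Proof.
move=> dF dG; under eq_fun do rewrite mxE.
have dFk k : differentiable (fun y => F y i k : R) x by exact: differentiable_sym_coord.
have dGk k : differentiable (fun y => G y k j : R) x by exact: differentiable_sym_coord.
have dFG k : differentiable (fun y => F y i k * G y k j : R) x.
  exact: (@differentiableM _ _ (fun y => F y i k : R) (fun y => G y k j)).
have [? dE] := diff_sum (index_enum 'I_n) dFG; split=> // v.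
rewrite dE !mxE -big_split; apply: eq_bigr => k _ /=.
by rewrite (diff_mul v (dFk k) (dGk k)) (diff_sym_coord v i k dF)
  (diff_sym_coord v k j dG).
Qed.

Lemma diff_mxtrace F G x : differentiable F x -> differentiable G x ->
  differentiable (fun y => \tr ((F y : 'M[R]_n) *m G y) : R) x /\
  forall v, 'd (fun y => \tr ((F y : 'M[R]_n) *m G y) : R) x v =
    \tr (('d F x v : 'M[R]_n) *m G x) + \tr ((F x : 'M[R]_n) *m 'd G x v).
Proof.
move=> dF dG; have dFG i := diff_mulmx i i dF dG.
have [? dE] := diff_sum (index_enum 'I_n) (fun i => (dFG i).1).
split=> // v; rewrite dE -mxtraceD; apply: eq_bigr => i _.
exact: (dFG i).2.
Qed.

End DiffSum.

(** * The explicit connection and its Levi-Civita properties *)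

Section Connection.
Context {R : realType} {n : nat}.
Implicit Types (S : sym R n) (X Y Z : sym R n -> sym R n) (A B : 'M[R]_n).

Lemma symzD A B : symz (A + B) = symz A + symz B.
Proof. by apply: sym_mxP; rewrite sym_mxD !symzE linearD /= addrACA. Qed.

Lemma symzZ (a : R) A : symz (a *: A) = a *: symz A.
Proof. by apply: sym_mxP; rewrite sym_mxZ !symzE linearZ scalerDr. Qed.

Lemma symz_tr A : symz A^T = symz A.
Proof. by apply: sym_mxP; rewrite !symzE trmxK addrC. Qed.

Lemma trmx_sym3 (A B C : sym R n) :
  ((A : 'M[R]_n) *m B *m C)^T = (C : 'M[R]_n) *m B *m A.
Proof. by rewrite !trmx_mul !trmx_sym mulmxA. Qed.

(** The transpose of [X0 S Y0] is [Y0 S X0], so [symz] yields the whole correction term with values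
    in [sym R n]. *)
Definition bw_connection X Y S : sym R n :=
  chart_deriv X Y S -
    symz ((lyapunov_inv S (X S) : 'M[R]_n) *m S *m lyapunov_inv S (Y S)).

Lemma bw_connectionE X Y S (X0 := lyapunov_inv S (X S)) (Y0 := lyapunov_inv S (Y S)) :
  bw_connection X Y S = (chart_deriv X Y S : 'M[R]_n) -
    ((X0 : 'M[R]_n) *m S *m Y0 + (Y0 : 'M[R]_n) *m S *m X0) :> 'M[R]_n.
Proof. by rewrite /bw_connection sym_mxB symzE trmx_sym3. Qed.

Lemma smooth_on_differentiable X S : smooth_on spd X -> spd S -> differentiable X S.
Proof. by move=> /(_ 1) [+ _]; apply. Qed.

Lemma smooth_bw_connection X Y : smooth_on spd X -> smooth_on spd Y ->
  smooth_on spd (bw_connection X Y).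
Proof.
move=> sX sY k; apply/(Ck_on_symP open_spd) => i j.
have cXij a b := (Ck_on_symP open_spd k X).1 (sX k) a b.
have cX0 := (Ck_on_symP open_spd k _).1 (Ck_on_lyapunov_inv (sX k)).
have cY0 := (Ck_on_symP open_spd k _).1 (Ck_on_lyapunov_inv (sY k)).
have cS a b : Ck_on spd k (fun S : sym R n => S a b : R).
  apply: (Ck_on_linear open_spd (l := sym_coord a b)).
  exact: sym_coord_continuous.
have cM a b : Ck_on spd k (fun S =>
    ((lyapunov_inv S (X S) : 'M[R]_n) *m S *m lyapunov_inv S (Y S)) a b : R).
  under eq_fun do rewrite mxE; apply: (Ck_on_sum open_spd) => l.
  apply: (Ck_on_mul open_spd) => //.
  under eq_fun do rewrite mxE; apply: (Ck_on_sum open_spd) => m.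
  exact: (Ck_on_mul open_spd).
(* [Ck_on] controls derivatives in fixed directions only, so the moving direction [X S] is expanded
   over the constant matrices [sym_delta a b]. One derivative is lost, hence the order [k.+1] for
   [Y]. *)
have cD : Ck_on spd k (fun S => (chart_deriv X Y S : 'M[R]_n) i j : R).
  have [_ dY] := sY k.+1.
  have := Ck_on_sum open_spd (index_enum 'I_n) xpredT (fun a =>
    Ck_on_sum open_spd (index_enum 'I_n) xpredT (fun b =>
      Ck_on_mul open_spd (cXij a b)
        ((Ck_on_symP open_spd k _).1 (dY (sym_delta a b)) i j))).
  apply: (Ck_on_eq open_spd) => S Sp.
  have -> : chart_deriv X Y S = \sum_a \sum_b X S a b *: 'd Y S (sym_delta a b).
    rewrite /chart_deriv {1}(sym_decomp (X S)) linear_sum; apply: eq_bigr => a _.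
    by rewrite linear_sum; apply: eq_bigr => b _; rewrite linearZ.
  rewrite sym_mx_sum summxE; apply: eq_bigr => a _.
  by rewrite sym_mx_sum summxE; apply: eq_bigr => b _; rewrite sym_mxZ [RHS]mxE.
have := Ck_on_add open_spd cD (Ck_on_mul open_spd
  (Ck_on_cst open_spd k (-1 : R)) (Ck_on_add open_spd (cM i j) (cM j i))).
apply: (Ck_on_eq open_spd) => S Sp.
rewrite mulN1r /bw_connection -[RHS]/(sym_coord i j _) linearB /=.
by congr (_ - _); rewrite [RHS]/sym_coord symzE [RHS]mxE [X in _ = _ + X]mxE.
Qed.

Lemma bw_connection_affine : affine_connection spd bw_connection.
Proof.
split.
- exact: smooth_bw_connection.
- move=> X X' Y _ _ _ S Sp; rewrite /bw_connection.
  rewrite {1}/chart_deriv (linearD ('d Y S)) (lyapunov_invD (X S) (X' S) Sp).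
  by rewrite sym_mxD !mulmxDl symzD opprD addrACA.
- move=> f X Y _ _ _ S Sp; rewrite /bw_connection.
  rewrite {1}/chart_deriv (linearZZ ('d Y S)) (lyapunov_invZ (f S) (X S) Sp).
  by rewrite sym_mxZ -!scalemxAl symzZ scalerBr.
- move=> X Y Y' _ sY sY' S Sp; rewrite /bw_connection.
  have dY := smooth_on_differentiable sY Sp.
  have dY' := smooth_on_differentiable sY' Sp.
  have -> : chart_deriv X (fun y => Y y + Y' y) S =
      chart_deriv X Y S + chart_deriv X Y' S.
    exact: (congr1 (fun h => h (X S)) (diffD dY dY')).
  rewrite (lyapunov_invD (Y S) (Y' S) Sp).
  by rewrite sym_mxD mulmxDr symzD opprD addrACA.
- move=> f X Y sf _ sY S Sp; rewrite /bw_connection.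
  rewrite (lyapunov_invZ (f S) (Y S) Sp) sym_mxZ -scalemxAr symzZ scalerBr addrA.
  congr (_ - _); rewrite /chart_deriv; apply: sym_mxP; apply/matrixP => i j.
  have dY : differentiable Y S by exact: smooth_on_differentiable.
  have df : differentiable f S by have [+ _] := sf 1; apply.
  (* Differentiability of the product field is obtained coordinatewise from C^1 regularity. *)
  have sfY : differentiable (fun y => f y *: Y y) S.
    have : Ck_on spd 1 (fun y => f y *: Y y).
      apply/(Ck_on_symP open_spd) => a b.
      apply: (Ck_on_eq open_spd) (Ck_on_mul open_spd (sf 1%N)
        ((Ck_on_symP open_spd _ _).1 (sY 1%N) a b)) => y _.
      by rewrite sym_mxZ [RHS]mxE.
    by move=> [+ _]; apply.
  rewrite -(diff_sym_coord (X S) i j sfY) sym_mxD !sym_mxZ.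
  under eq_fun do rewrite sym_mxZ mxE.
  rewrite (diff_mul (X S) df (differentiable_sym_coord i j dY)).
  by rewrite (diff_sym_coord (X S) i j dY) [RHS]mxE [X in _ = X + _]mxE [X in _ = _ + X]mxE.
Qed.

Lemma bw_connection_torsion_free : torsion_free spd bw_connection.
Proof.
move=> X Y _ _ S _; rewrite /bw_connection /lie_bracket -[in X in _ - X]symz_tr trmx_sym3.
by rewrite opprB addrA subrK.
Qed.

Lemma mxtrace_mulBl A B (C : 'M[R]_n) :
  \tr ((A - B) *m C) = \tr (A *m C) - \tr (B *m C).
Proof. by rewrite mulmxBl raddfB. Qed.

(** Applied to [X0], [Y0], [Z0], this matches the term produced by differentiating the Lyapunov
    equation with the two corrections in the compatibility identity. Both sides are the same four
    traces up to cyclic permutation. *)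
Lemma mxtrace_bw_compat (S X Y Z : 'M[R]_n) :
  \tr (Y *m ((S *m X + X *m S) *m Z + Z *m (S *m X + X *m S))) =
  \tr ((X *m S *m Y + Y *m S *m X) *m Z) + \tr ((X *m S *m Z + Z *m S *m X) *m Y).
Proof.
rewrite !(mulmxDl, mulmxDr) !mxtraceD !mulmxA.
rewrite -(mulmxA (X *m S) Y Z) (mxtrace_mulC (X *m S)) mulmxA.
rewrite (mxtrace_mulC _ Y) (mxtrace_mulC _ Y) !mulmxA.
lra.
Qed.

(** The equation [Z T = T Z0(T) + Z0(T) T] holds for all [T] near [S], so it can be differentiated
    there, entry by entry, with the product rule. *)
Lemma diff_lyapunov_inv Z S (v : sym R n) : smooth_on spd Z -> spd S ->
  let Z0 := fun S => lyapunov_inv S (Z S) in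
  differentiable Z0 S /\
  (S : 'M[R]_n) *m 'd Z0 S v + ('d Z0 S v : 'M[R]_n) *m S =
  ('d Z S v : 'M[R]_n) - ((v : 'M[R]_n) *m Z0 S + (Z0 S : 'M[R]_n) *m v).
Proof.
move=> sZ Sp Z0.
have dZ0 : differentiable Z0 S.
  by apply: (smooth_on_differentiable _ Sp) => k; exact: Ck_on_lyapunov_inv.
split=> //.
suff dZE : ('d Z S v : 'M[R]_n) =
    ((v : 'M[R]_n) *m Z0 S + (S : 'M[R]_n) *m 'd Z0 S v) +
    (('d Z0 S v : 'M[R]_n) *m S + (Z0 S : 'M[R]_n) *m v).
  rewrite [X in _ = X - _]dZE; move: ('d Z0 S v) => W.
  by rewrite (addrC ((v : 'M[R]_n) *m _)) addrACA addrK.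
apply/matrixP => i j.
have did : differentiable (@id (sym R n)) S by exact: ex_diff.
pose h1 (T : sym R n) : R := ((T : 'M[R]_n) *m Z0 T) i j.
pose h2 (T : sym R n) : R := ((Z0 T : 'M[R]_n) *m T) i j.
have dI : 'd (@id (sym R n)) S v = v by rewrite diff_val.
have [d1 /(_ v) e1] : differentiable h1 S /\ _ := diff_mulmx i j did dZ0.
have [d2 /(_ v) e2] : differentiable h2 S /\ _ := diff_mulmx i j dZ0 did.
have {}e1 := etrans e1 (congr1 (fun W : sym R n =>
  ((W : 'M[R]_n) *m Z0 S + (S : 'M[R]_n) *m 'd Z0 S v) i j) dI).
have {}e2 := etrans e2 (congr1 (fun W : sym R n =>
  (('d Z0 S v : 'M[R]_n) *m S + (Z0 S : 'M[R]_n) *m W) i j) dI).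
have ZE : \forall T \near S, (h1 + h2) T = Z T i j.
  apply: filterS (open_nbhs_nbhs (conj open_spd Sp)) => T Tp.
  by rewrite (lyapunov_invP (Z T) Tp) [RHS]mxE.
have [_ E] := near_eq_diff ZE (differentiableD d1 d2).
have dZ := smooth_on_differentiable sZ Sp.
have EZ : 'd Z S v i j = 'd h1 S v + 'd h2 S v.
  apply: etrans (esym (diff_sym_coord v i j dZ)) _.
  exact: (congr1 (fun h => h v) (etrans E (diffD d1 d2))).
by rewrite [RHS]mxE EZ e1 e2.
Qed.

Lemma bw_connection_compatible : metric_compatible spd bw_metric bw_connection.
Proof.
move=> X Y Z sX sY sZ S Sp.
pose Z0 := fun S => lyapunov_inv S (Z S).
have [dZ0 LZ0] := diff_lyapunov_inv (X S) sZ Sp; rewrite -/Z0 in dZ0 LZ0.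
have dY := smooth_on_differentiable sY Sp.
have [dt et] := diff_mxtrace dY dZ0.
have gE : \forall T \near S,
    2^-1 * \tr ((Y T : 'M[R]_n) *m Z0 T) = bw_metric T (Y T) (Z T).
  apply: filterS (open_nbhs_nbhs (conj open_spd Sp)) => T Tp.
  by rewrite bw_metricE.
have [_ ->] := near_eq_diff gE (differentiableZ 2^-1 dt).
rewrite (diffZ 2^-1 dt) /= et !bw_metricE // (mxtrace_lyapunov_invC (Y S)) //.
rewrite -[RHS]mulrDr; congr (_ * _).
rewrite !bw_connectionE.
set X0 := lyapunov_inv S (X S); set Y0 := lyapunov_inv S (Y S).
rewrite -/(Z0 S).
(* Self-adjointness moves the Lyapunov operator from [Y0] onto the derivative of [Z0], where
   [diff_lyapunov_inv] evaluates it. *)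
have -> : \tr ((Y S : 'M[R]_n) *m 'd Z0 S (X S)) =
   \tr (('d Z S (X S) : 'M[R]_n) *m Y0)
     - \tr ((Y0 : 'M[R]_n) *m ((X S : 'M[R]_n) *m Z0 S + (Z0 S : 'M[R]_n) *m X S)).
  rewrite (lyapunov_invP (Y S) Sp) -/Y0 lyapunov_selfadjoint LZ0.
  by rewrite mulmxBr raddfB /= (mxtrace_mulC Y0).
rewrite (lyapunov_invP (X S) Sp) -/X0 mxtrace_bw_compat.
by rewrite !mxtrace_mulBl addrACA -opprD addrA.
Qed.

Lemma bw_connection_levi_civita : levi_civita spd bw_metric bw_connection.
Proof.
split; [exact: bw_connection_affine | exact: bw_connection_torsion_free |].
exact: bw_connection_compatible.
Qed.

End Connection.

(** * Uniqueness of the Levi-Civita connection *)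

Section Uniqueness.
Context {R : realType} {n : nat}.
Implicit Types (S : sym R n) (A B C : sym R n).

Lemma bw_metricC S A B : spd S -> bw_metric S A B = bw_metric S B A.
Proof. by move=> Sp; rewrite !bw_metricE // mxtrace_lyapunov_invC. Qed.

Lemma bw_metricBl S A B C : spd S ->
  bw_metric S (A - B) C = bw_metric S A C - bw_metric S B C.
Proof. by move=> Sp; rewrite !bw_metricE // sym_mxB mxtrace_mulBl mulrBr. Qed.

(** With [A0] the Lyapunov solution for [A], the value is [tr (A0 S A0)]; its vanishing forces
    [A0 = 0], hence [A = 0]. *)
Lemma bw_metric_eq0 S A : spd S -> bw_metric S A A = 0 -> A = 0.
Proof.
move=> Sp; rewrite bw_metricE //.
have := lyapunov_invP A Sp; move: (lyapunov_inv S A) => A0 AE /eqP.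
rewrite mulf_eq0 invr_eq0 pnatr_eq0 /=.
rewrite AE lyapunov_selfadjoint mulmxDr mxtraceD mulmxA.
rewrite [X in _ + X]mxtrace_mulC -mulr2n mulrn_eq0 /= -{1}(trmx_sym A0).
move=> /eqP/(spd_mxtrace_eq0 Sp) A00.
by apply: sym_mxP; rewrite AE A00 mulmx0 mul0mx addr0.
Qed.

Lemma levi_civita_bw_unique nabla nabla' X Y S :
  levi_civita spd bw_metric nabla -> levi_civita spd bw_metric nabla' ->
  smooth_on spd X -> smooth_on spd Y -> spd S ->
  nabla X Y S = nabla' X Y S.
Proof.
move=> [_ tf mc] [_ tf' mc'] sX sY Sp.
pose D X Y : sym R n := nabla X Y S - nabla' X Y S.
pose c X Y Z := bw_metric S (D X Y) (Z S).
have DC X1 Y1 : smooth_on spd X1 -> smooth_on spd Y1 -> D X1 Y1 = D Y1 X1.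
  move=> sX1 sY1; apply/eqP; rewrite -subr_eq0; apply/eqP.
  have := tf _ _ sX1 sY1 _ Sp; rewrite -(tf' _ _ sX1 sY1 _ Sp) => /eqP.
  rewrite -subr_eq0 => /eqP <-.
  by rewrite /D !opprB addrACA [in RHS]addrACA; congr (_ + _); rewrite addrC.
have cC X1 Y1 Z1 : smooth_on spd X1 -> smooth_on spd Y1 -> c X1 Y1 Z1 = c Y1 X1 Z1.
  by move=> sX1 sY1; rewrite /c DC.
have cN X1 Y1 Z1 : smooth_on spd X1 -> smooth_on spd Y1 -> smooth_on spd Z1 ->
    c X1 Y1 Z1 = - c X1 Z1 Y1.
  move=> sX1 sY1 sZ1; rewrite /c /D !bw_metricBl //.
  have := mc _ _ _ sX1 sY1 sZ1 _ Sp; rewrite (mc' _ _ _ sX1 sY1 sZ1 _ Sp).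
  rewrite !(bw_metricC (Y1 S)) //; lra.
(* The constant field with value [D X Y] is smooth and makes [c X Y Z] the squared norm of
   [D X Y]. *)
pose Z (_ : sym R n) := D X Y.
have sZ : smooth_on spd Z by move=> k; exact: (Ck_on_cst open_spd).
have cXYZ : c X Y Z = - c X Y Z.
  (* Alternating the two symmetries six times returns to [c X Y Z] after three sign changes. *)
  rewrite {1}(cN _ _ _ sX sY sZ) (cC _ _ _ sX sZ) (cN _ _ _ sZ sX sY).
  by rewrite (cC _ _ _ sZ sY) (cN _ _ _ sY sZ sX) (cC _ _ _ sY sX) !opprK.
have : D X Y = 0 by apply: (bw_metric_eq0 Sp); move: cXYZ; rewrite /c /Z; lra.
by move=> /subr0_eq.
Qed.

End Uniqueness.

Theorem mainTheorem4 (R : realType) (n : nat) :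
  (exists nabla : (sym R n -> sym R n) -> (sym R n -> sym R n) ->
                  (sym R n -> sym R n),
     levi_civita spd bw_metric nabla) /\
  (forall nabla : (sym R n -> sym R n) -> (sym R n -> sym R n) ->
                  (sym R n -> sym R n),
     levi_civita spd bw_metric nabla ->
     forall X Y : sym R n -> sym R n,
       smooth_on spd X -> smooth_on spd Y ->
     forall S : sym R n, spd S ->
     exists X0 Y0 : sym R n,
       [/\ unique (lyapunov_sol S (X S)) X0,
           unique (lyapunov_sol S (Y S)) Y0
         & nabla X Y S
             = (chart_deriv X Y S : 'M[R]_n)
               - (X0 *m S *m Y0 + Y0 *m S *m X0) :> 'M[R]_n]).
Proof.
split; first by exists bw_connection; exact: bw_connection_levi_civita.
move=> nabla lc X Y sX sY S Sp.
exists (lyapunov_inv S (X S)), (lyapunov_inv S (Y S)); split.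
- by split=> [|Z]; [exact: lyapunov_invP|exact: lyapunov_sol_unique].
- by split=> [|Z]; [exact: lyapunov_invP|exact: lyapunov_sol_unique].
rewrite (levi_civita_bw_unique lc bw_connection_levi_civita sX sY Sp).
exact: bw_connectionE.
Qed.
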